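(* Let $n\ge 1$, let $\mathcal{H}_k$ be a regular reproducing kernel Hilbert space over $\mathbb{B}^n$, let $\mathcal{E}_1$ and $\mathcal{E}_2$ be Hilbert spaces, and let $\mathcal{Q}_1$ and $\mathcal{Q}_2$ be shift co-invariant (closed) subspaces of $H^2_n \otimes \mathcal{E}_1$ and $\mathcal{H}_k \otimes \mathcal{E}_2$, respectively. Let $X \in \mathcal{B}(\mathcal{Q}_1, \mathcal{Q}_2)$, and suppose that $\|X\| \leq 1$ and \[ X \big(P_{\mathcal{Q}_1} (M_{z_i} \otimes I_{\mathcal{E}_1})|_{\mathcal{Q}_1}\big) = \big(P_{\mathcal{Q}_2} (M_{z_i} \otimes I_{\mathcal{E}_2})|_{\mathcal{Q}_2}\big) X \] for all $i = 1, \ldots, n$. Then there exists a multiplier $\Phi \in \mathcal{M}_1(H^2_n \otimes \mathcal{E}_1, \mathcal{H}_k \otimes \mathcal{E}_2)$ such that \[ X = P_{\mathcal{Q}_2} M_{\Phi}|_{\mathcal{Q}_1}. \]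
   Context: All Hilbert spaces are complex, and $\mathcal{B}(\mathcal{H},\mathcal{K})$ denotes the bounded linear operators from $\mathcal{H}$ to $\mathcal{K}$. $\mathbb{B}^n = \{\bm{z} \in \mathbb{C}^n : \sum_{i=1}^n |z_i|^2 < 1\}$. A kernel on $\mathbb{B}^n$ is a positive (semi-)definite function $\mathbb{B}^n\times\mathbb{B}^n\to\mathbb{C}$. The Drury-Arveson space $H^2_n$ is the reproducing kernel Hilbert space on $\mathbb{B}^n$ with kernel $k_1(\bm{z},\bm{w}) = (1 - \sum_{i=1}^n z_i \bar{w}_i)^{-1}$. A kernel $k:\mathbb{B}^n\times\mathbb{B}^n\to\mathbb{C}$, analytic in the first variables $z_1,\dots,z_n$, is called regular if there is a kernel $\tilde{k}:\mathbb{B}^n\times\mathbb{B}^n\to\mathbb{C}$, analytic in $z_1,\dots,z_n$, such that $k(\bm{z},\bm{w}) = k_1(\bm{z},\bm{w})\tilde{k}(\bm{z},\bm{w})$ for all $\bm{z},\bm{w}\in\mathbb{B}^n$. The reproducing kernel Hilbert space $\mathcal{H}_k$ of a regular kernel $k$ is called a regular reproducing kernel Hilbert space. On such a space (in particular on $H^2_n$) the multiplication operator $M_{z_i}$ by the coordinate function $z_i$ is bounded for each $i$. For a Hilbert space $\mathcal{E}$, the Hilbert space tensor product $\mathcal{H}_k\otimes\mathcal{E}$ is identified with the reproducing kernel Hilbert space of $\mathcal{E}$-valued functions on $\mathbb{B}^n$ with kernel $k(\bm{z},\bm{w})I_{\mathcal{E}}$. A closed subspace $\mathcal{Q}\subseteq\mathcal{H}_k\otimes\mathcal{E}$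 is shift co-invariant if $(M_{z_i}\otimes I_{\mathcal{E}})^*\mathcal{Q}\subseteq\mathcal{Q}$ for $i=1,\dots,n$. $P_{\mathcal{Q}}$ denotes the orthogonal projection onto $\mathcal{Q}$. A function $\Phi:\mathbb{B}^n\to\mathcal{B}(\mathcal{E}_1,\mathcal{E}_2)$ is a multiplier from $H^2_n\otimes\mathcal{E}_1$ to $\mathcal{H}_k\otimes\mathcal{E}_2$ if the pointwise product $\Phi F$ lies in $\mathcal{H}_k\otimes\mathcal{E}_2$ for every $F\in H^2_n\otimes\mathcal{E}_1$; $M_\Phi$ denotes the resulting bounded multiplication operator $F\mapsto\Phi F$, where $(\Phi F)(\bm{w})=\Phi(\bm{w})F(\bm{w})$. $\mathcal{M}_1(H^2_n\otimes\mathcal{E}_1,\mathcal{H}_k\otimes\mathcal{E}_2)$ is the set of such multipliers with $\|M_\Phi\|\le 1$. *)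

(* Defs.v *)
From HB Require Import structures.
From mathcomp Require Import all_boot all_order all_algebra finmap.
From mathcomp Require Import complex.
From mathcomp Require Import boolp classical_sets functions reals ereal.
From mathcomp Require Import topology normedtype summability.

Set Implicit Arguments.
Unset Strict Implicit.
Unset Printing Implicit Defensive.

Import Order.TTheory GRing.Theory Num.Theory.
Import numFieldNormedType.Exports.

Local Open Scope classical_set_scope.
Local Open Scope ring_scope.
Local Open Scope complex_scope.

(* The form is linear in its first argument and conjugate-linear in the
   second.  The norm of [V] takes its values in the nonnegative reals of
   [R[i]]. *)
HB.mixin Record CompleteNormedModule_isHilbert (R : realType) V
    & CompleteNormedModule R[i] V := {
  hdot : {dot V for Num.conj};
  hdot_norm : forall x : V, `|x| ^+ 2 = hdot x x
}.

#[short(type="hilbertType")]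
HB.structure Definition Hilbert (R : realType) :=
  {V of CompleteNormedModule R[i] V & CompleteNormedModule_isHilbert R V}.

Section Operators.
Context {R : realType}.
Implicit Types U V H : hilbertType R.

Definition closed_subspace H (Q : set H) : Prop :=
  [/\ closed Q, Q 0 & forall (a : R[i]) x y, Q x -> Q y -> Q (a *: x + y)].

(* An operator on a subspace [D] of [U] is represented by a function on [U]
   whose values outside [D] are irrelevant. *)
Definition opnorm U V (D : set U) (T : U -> V) : \bar R :=
  ereal_sup [set (complex.Re `|T x|)%:E | x in D `&` [set x | `|x| <= 1]].

Definition bounded_op U V (D : set U) (D' : set V) (T : U -> V) : Prop :=
  [/\ forall (a : R[i]) x y, D x -> D y -> T (a *: x + y) = a *: T x + T y,
      forall x, D x -> D' (T x)
    & (opnorm D T < +oo)%E].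

(* [orth_proj], [adjoint] and, below, [mul_op] denote the unique vector with the
   defining property; the default value 0 is only used if there is none.  For
   a closed subspace [Q], a bounded [T] and a multiplier [Phi] it always
   exists; the coordinate functions are multipliers of the space of a regular
   kernel. *)
Definition orth_proj H (Q : set H) (x : H) : H :=
  xget 0 [set q | Q q /\ forall u, Q u -> hdot (x - q) u = 0].

Definition adjoint U V (T : U -> V) (y : V) : U :=
  xget 0 [set x | forall u, hdot (T u) y = hdot u x].

End Operators.

Section Kernels.
Context {R : realType}.

Definition unit_ball (n : nat) : Type :=
  {z : 'rV[R[i]]_n | \sum_(i < n) `|z 0 i| ^+ 2 < 1}.

Definition crd n (z : unit_ball n) (i : 'I_n) : R[i] := sval z 0 i.

(* Around each point of the ball, [f] is the sum of an unconditionally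
   convergent power series. *)
Definition analytic n (f : unit_ball n -> R[i]) : Prop :=
  forall a : unit_ball n,
  exists (c : {ffun 'I_n -> nat} -> R[i]) (r : R), 0 < r /\
    forall z : unit_ball n, (forall i, `|crd z i - crd a i| < r%:C) ->
      partial_sum (fun al : {ffun 'I_n -> nat} =>
        c al * \prod_(i < n) (crd z i - crd a i) ^+ al i : R[i]^o) @ totally
        --> (f z : R[i]^o).

Definition psd_kernel n (k : unit_ball n -> unit_ball n -> R[i]) : Prop :=
  forall (m : nat) (z : 'I_m -> unit_ball n) (c : 'I_m -> R[i]),
    0 <= \sum_(i < m) \sum_(j < m) (c i)^* * c j * k (z i) (z j).

Definition analytic_kernel n (k : unit_ball n -> unit_ball n -> R[i]) : Prop :=
  psd_kernel k /\ forall w, analytic (fun z => k z w).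

Definition da_kernel n (z w : unit_ball n) : R[i] :=
  (1 - \sum_(i < n) crd z i * (crd w i)^*)^-1.

Definition regular_kernel n (k : unit_ball n -> unit_ball n -> R[i]) : Prop :=
  analytic_kernel k /\
  exists2 k' : unit_ball n -> unit_ball n -> R[i],
    analytic_kernel k' & forall z w, k z w = da_kernel z w * k' z w.

(* The reproducing kernel Hilbert space with the operator-valued kernel
   [k(z, w) I_E]; this is the Hilbert space tensor product of the scalar space of
   [k] and [E].  A vector [F] stands for the function [w |-> rk_eval w F]. *)
Record rkhs n (k : unit_ball n -> unit_ball n -> R[i]) (E : hilbertType R) :=
  RKHS {
  rk_space :> hilbertType R;
  rk_eval : unit_ball n -> {linear rk_space -> E};
  rk_eval_inj : forall F G : rk_space,
    (forall w, rk_eval w F = rk_eval w G) -> F = G;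
  rk_reproducing : forall (w : unit_ball n) (eta : E),
    exists2 K : rk_space,
      forall z, rk_eval z K = k z w *: eta &
      forall F : rk_space, hdot F K = hdot (rk_eval w F) eta
}.

Section Multipliers.
Context {n : nat} {k1 k2 : unit_ball n -> unit_ball n -> R[i]}.
Context {E1 E2 : hilbertType R} (H1 : rkhs k1 E1) (H2 : rkhs k2 E2).

Definition is_multiplier (Phi : unit_ball n -> E1 -> E2) : Prop :=
  (forall w, bounded_op setT setT (Phi w)) /\
  forall F : H1, exists G : H2, forall w, rk_eval H2 w G = Phi w (rk_eval H1 w F).

Definition mul_op (Phi : unit_ball n -> E1 -> E2) (F : H1) : H2 :=
  xget 0 [set G : H2 | forall w, rk_eval H2 w G = Phi w (rk_eval H1 w F)].

Definition contractive_multiplier (Phi : unit_ball n -> E1 -> E2) : Prop :=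
  is_multiplier Phi /\ (opnorm setT (mul_op Phi) <= 1)%E.

End Multipliers.


(* Under the identification above, the tensor product of multiplication by
   [z_i] with the identity of [E] is multiplication by [z_i] of [E]-valued
   functions. *)
Definition coord_shift n (k : unit_ball n -> unit_ball n -> R[i]) (E : hilbertType R)
    (H : rkhs k E) (i : 'I_n) : H -> H :=
  @mul_op n k k E E H H (fun w (x : E) => crd w i *: x).

Definition shift_coinvariant n (k : unit_ball n -> unit_ball n -> R[i])
    (E : hilbertType R) (H : rkhs k E) (Q : set H) : Prop :=
  forall (i : 'I_n) (F : H), Q F -> Q (adjoint (@coord_shift n k E H i) F).

End Kernels.

Arguments unit_ball R n : clear implicits.
Arguments da_kernel {R} n z w.
Arguments rk_eval {R n k E} r w.
Arguments is_multiplier {R n k1 k2 E1 E2} H1 H2 Phi.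
Arguments mul_op {R n k1 k2 E1 E2} H1 H2 Phi F.
Arguments contractive_multiplier {R n k1 k2 E1 E2} H1 H2 Phi.
Arguments coord_shift {R n k E} H i F.
Arguments shift_coinvariant {R n k E} H Q.

(* Main.v *)
Require Import Defs.
From mathcomp Require Import all_boot all_order all_algebra complex.
From mathcomp Require Import boolp classical_sets reals ereal topology normedtype.
From mathcomp Require Import sequences.
From mathcomp Require Import ring lra.

Set Implicit Arguments.
Unset Strict Implicit.
Unset Printing Implicit Defensive.

Import Order.TTheory GRing.Theory Num.Theory.
Import numFieldNormedType.Exports.
Local Open Scope classical_set_scope.
Local Open Scope ring_scope.
Local Open Scope complex_scope.

(** Write S and T for the adjoints of the coordinate shifts of H1 and H2.  The
    graph of X^* : Q2 -> Q1 is a (T, S)-invariant contractive subspace of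
    H2 * H1; by Zorn's lemma it lies in a maximal one.  Every kernel vector
    v = k_w eta of H2 can be adjoined to such a graph, with some K_w zeta of H1
    as its partner: after composing with U = 1 - sum_i w_i T_i (resp. S_i),
    contractivity is compared through
      |U F|^2 = c (|F|^2 - sum_i |T_i F|^2) + |sum_i w_i A_i F|^2 + c sum_i |A_i F|^2
    with c = 1 - |w|^2 and A_i = T_i - conj(w_i), where A_i v = 0.  The first
    bracket is nonnegative for H2 and equals |F(0)|^2 for H1, so that zeta solves
    a minimization problem in E1.  Hence a maximal graph contains a pair
    (k_w eta, K_w zeta) for all w and eta, and the adjoint of the contraction
    with this graph is a multiplication operator. *)

(** * Real inner products and squared norms *)

Section HilbertGeometry.
Context {R : realType}.
Implicit Types (H : hilbertType R) (a : R[i]) (r : R).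

(** Norms and products of a [hilbertType] lie in [R[i]]; estimates are carried out with these
    real-valued counterparts. *)
Definition ip H (x y : H) : R := complex.Re (hdot x y).
Definition nsq H (x : H) : R := ip x x.
Definition csq a : R := complex.Re a ^+ 2 + complex.Im a ^+ 2.

Lemma hdotC H (x y : H) : hdot x y = conjc (hdot y x).
Proof. by rewrite (hermC (@hdot R H) x y) expr0 mul1r. Qed.

Lemma hdotDl H (x y z : H) : hdot (x + y) z = hdot x z + hdot y z.
Proof. exact: linearDl. Qed.

Lemma hdotDr H (x y z : H) : hdot x (y + z) = hdot x y + hdot x z.
Proof. exact: linearDr. Qed.

Lemma hdotZl H a (x y : H) : hdot (a *: x) y = a * hdot x y.
Proof. exact: linearZl_LR. Qed.

Lemma hdotZr H a (x y : H) : hdot x (a *: y) = conjc a * hdot x y.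
Proof. exact: linearZr_LR. Qed.

Lemma hdot0l H (x : H) : hdot 0 x = 0.
Proof. exact: linear0l. Qed.

Lemma hdot0r H (x : H) : hdot x 0 = 0.
Proof. exact: linear0r. Qed.

Lemma hdotBl H (x y z : H) : hdot (x - y) z = hdot x z - hdot y z.
Proof. exact: linearBl. Qed.

Lemma hdotBr H (x y z : H) : hdot x (y - z) = hdot x y - hdot x z.
Proof. exact: linearBr. Qed.

Lemma hdot_suml H (I : Type) (s : seq I) (F : I -> H) (y : H) :
  hdot (\sum_(j <- s) F j) y = \sum_(j <- s) hdot (F j) y.
Proof. exact: linear_sumlz. Qed.

Lemma hdot_sumr H (I : Type) (s : seq I) (F : I -> H) (y : H) :
  hdot y (\sum_(j <- s) F j) = \sum_(j <- s) hdot y (F j).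
Proof. exact: linear_sumr. Qed.

Lemma ReD a b : complex.Re (a + b) = complex.Re a + complex.Re b.
Proof. by case: a b => [? ?] [? ?]. Qed.

Lemma ReN a : complex.Re (- a) = - complex.Re a.
Proof. by case: a. Qed.

Lemma Re_realM r a : complex.Re (r%:C * a) = r * complex.Re a.
Proof. by case: a => x y /=; rewrite mul0r subr0. Qed.

Lemma Re_conj a : complex.Re (conjc a) = complex.Re a.
Proof. by case: a. Qed.

Lemma Re_sum (I : Type) (s : seq I) (P : pred I) (F : I -> R[i]) :
  complex.Re (\sum_(j <- s | P j) F j) = \sum_(j <- s | P j) complex.Re (F j).
Proof. exact: (big_morph _ ReD). Qed.

(** The factors 1 and i recover the real and the imaginary part; identities for [ip] thereby lift to
    [hdot]. *)
Lemma eq_Re_scaled a b :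
  (forall c : R[i], complex.Re (c * a) = complex.Re (c * b)) -> a = b.
Proof.
case: a b => [a1 a2] [b1 b2] e; have := e 1; have := e 'i%C => /=.
by move=> e1 e2; congr Complex; lra.
Qed.

Lemma ipC H (x y : H) : ip x y = ip y x.
Proof. by rewrite /ip hdotC Re_conj. Qed.

Lemma ipDl H (x y z : H) : ip (x + y) z = ip x z + ip y z.
Proof. by rewrite /ip hdotDl ReD. Qed.

Lemma ipDr H (x y z : H) : ip x (y + z) = ip x y + ip x z.
Proof. by rewrite /ip hdotDr ReD. Qed.

Lemma ipNl H (x y : H) : ip (- x) y = - ip x y.
Proof. by rewrite /ip linearNl ReN. Qed.

Lemma ipNr H (x y : H) : ip x (- y) = - ip x y.
Proof. by rewrite ipC ipNl ipC. Qed.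

Lemma ipZl H r (x y : H) : ip (r%:C *: x) y = r * ip x y.
Proof. by rewrite /ip hdotZl Re_realM. Qed.

Lemma ipZr H r (x y : H) : ip x (r%:C *: y) = r * ip x y.
Proof. by rewrite ipC ipZl ipC. Qed.

Lemma ipZJ H a (x y : H) : ip (a *: x) y = ip x (conjc a *: y).
Proof. by rewrite /ip hdotZl hdotZr; case: a => x1 x2; rewrite /= opprK. Qed.

Lemma ip_suml H (I : Type) (s : seq I) (F : I -> H) (y : H) :
  ip (\sum_(j <- s) F j) y = \sum_(j <- s) ip (F j) y.
Proof. by rewrite /ip hdot_suml Re_sum. Qed.

Lemma nsqE H (x : H) : `|x| ^+ 2 = (nsq x)%:C.
Proof.
rewrite /nsq /ip -hdot_norm; apply/esym/RRe_real.
by rewrite rpredX // normr_real.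
Qed.

Lemma hdotxx H (x : H) : hdot x x = (nsq x)%:C.
Proof. by rewrite -hdot_norm nsqE. Qed.

Lemma nsq_ge0 H (x : H) : 0 <= nsq x.
Proof. by rewrite -ler0c -nsqE exprn_ge0. Qed.

Lemma nsq_eq0 H (x : H) : nsq x = 0 -> x = 0.
Proof.
by move=> x0; apply/eqP; rewrite -normr_eq0 -sqrf_eq0 nsqE x0.
Qed.

Lemma nsq0 H : nsq (0 : H) = 0.
Proof. by rewrite /nsq /ip hdot0l. Qed.

Lemma nsqZ H a (x : H) : nsq (a *: x) = csq a * nsq x.
Proof.
apply: complexI; rewrite -nsqE normrZ exprMn nsqE.
by rewrite -add_Re2_Im2 /csq -rmorphM.
Qed.

Lemma nsqD H (x y : H) : nsq (x + y) = nsq x + 2 * ip x y + nsq y.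
Proof. by rewrite /nsq !ipDl !ipDr (ipC y x); ring. Qed.

Lemma nsqN H (x : H) : nsq (- x) = nsq x.
Proof. by rewrite /nsq ipNl ipNr opprK. Qed.

(** The exact convexity defect of the squared norm, from which the hypothesis of [minimizer] is
    checked. *)
Lemma nsq_conv H (t : R) (x y : H) :
  nsq (t%:C *: x + (1 - t)%:C *: y) =
  t * nsq x + (1 - t) * nsq y - t * (1 - t) * nsq (x - y).
Proof.
rewrite !nsqD !nsqZ ipZl ipZr nsqN ipNr /csq /= !expr0n !addr0.
by move: (nsq x) (nsq y) (ip x y) => *; ring.
Qed.

Lemma nsqB H (x y : H) : nsq (x - y) = nsq x - 2 * ip x y + nsq y.
Proof. by rewrite nsqD ipNr nsqN; ring. Qed.

Lemma csq_ge0 a : 0 <= csq a.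
Proof. by rewrite addr_ge0 // sqr_ge0. Qed.

Lemma csq_real r : csq r%:C = r ^+ 2.
Proof. by rewrite /csq /= expr0n addr0. Qed.

Lemma csq_eq0 a : csq a = 0 -> a = 0.
Proof.
by move=> a0; apply/eqP; rewrite -normr_eq0 -sqrf_eq0 -add_Re2_Im2 -/(csq a) a0.
Qed.

Lemma csqJ a : csq (conjc a) = csq a.
Proof. by case: a => x y; rewrite /csq /= sqrrN. Qed.

(** Expand |r x - y|^2 >= 0 and divide by r. The case r = 1 stands in for the Cauchy-Schwarz
    inequality. *)
Lemma ip_young H r (x y : H) : 0 < r -> 2 * ip x y <= r * nsq x + r^-1 * nsq y.
Proof.
move=> r0; have := nsq_ge0 (r%:C *: x - y).
rewrite nsqB ipZl nsqZ /csq /= expr0n addr0 => h.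
rewrite -(ler_pM2l r0) mulrDr !mulrA mulfV ?gt_eqF // mul1r; lra.
Qed.

Lemma nrmE H (x : H) : `|x| = (Num.sqrt (nsq x))%:C.
Proof.
apply/eqP; rewrite -(@eqrXn2 _ 2) ?normr_ge0 ?ler0c ?sqrtr_ge0 //.
by rewrite nsqE -rmorphXn /= sqr_sqrtr ?nsq_ge0.
Qed.

Lemma ler_sqrtD H (x y : H) :
  Num.sqrt (nsq (x + y)) <= Num.sqrt (nsq x) + Num.sqrt (nsq y).
Proof. by rewrite -lecR rmorphD /= -!nrmE ler_normD. Qed.

End HilbertGeometry.

(** * Minimizing sequences and Riesz representation *)

Section Minimization.
Context {R : realType}.
Implicit Types (H E : hilbertType R).

Lemma nrm_lt H (x : H) (e : R[i]) : 0 < e -> nsq x < complex.Re e ^+ 2 -> `|x| < e.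
Proof.
case: e => e1 e2; rewrite ltcE /= => /andP[/eqP-> e0] lt.
rewrite nrmE ltcE /= eqxx /= -[X in _ < X](gtr0_norm e0) -sqrtr_sqr.
by rewrite ltr_sqrt // exprn_gt0.
Qed.

Lemma nsq_lt H (x : H) (e : R) : 0 < e -> `|x| < (Num.sqrt e)%:C -> nsq x < e.
Proof. by move=> e0; rewrite nrmE ltcR ltr_sqrt. Qed.

Lemma nsq_complete H (u : nat -> H) :
  (forall e : R, 0 < e ->
     exists K, forall k, (K <= k)%N -> nsq (u K - u k) < e) ->
  exists zeta, forall e : R, 0 < e ->
     exists K, forall k, (K <= k)%N -> nsq (u k - zeta) < e.
Proof.
move=> cau; have /cauchy_cvgP/cvg_ex[zeta cz] : cauchy (u @ \oo).
  apply: cauchy_exP => e e0.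
  have e1 : 0 < complex.Re e by move: e0; rewrite ltcE => /andP[].
  have [K KP] := cau _ (exprn_gt0 2 e1); exists (u K); exists K => //= k Kk.
  by rewrite -ball_normE /ball_ /=; apply: nrm_lt => //; exact: KP.
exists zeta => e e0.
have se0 : 0 < (Num.sqrt e)%:C by rewrite ltcR sqrtr_gt0.
have /cvgrPdist_lt/(_ _ se0)[K _ KP] := cz; exists K => k Kk.
by apply: nsq_lt => //; rewrite distrC; exact: KP.
Qed.

Lemma closed_nsq H (Q : set H) (x : H) : closed Q ->
  (forall e : R, 0 < e -> exists2 q, Q q & nsq (q - x) < e) -> Q x.
Proof.
move=> cQ app; apply: cQ => B /nbhs_ballP[e /= e0 eB].
have e1 : 0 < complex.Re e by move: e0; rewrite ltcE => /andP[].
have [q Qq lt] := app _ (exprn_gt0 2 e1); exists q; split=> //; apply: eB.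
by rewrite -ball_normE /ball_ /= distrC; apply: nrm_lt.
Qed.

(* The hypothesis on [J] is the parallelogram identity of a quadratic function
   whose leading part dominates [nsq (y x)]. *)
Lemma minimizer E (I : Type) (i0 : I) (J : I -> R) (y : I -> E) (m0 : R) :
  (forall x, m0 <= J x) ->
  (forall x x' (t : R), 0 < t < 1 -> exists x'',
     J x'' <= t * J x + (1 - t) * J x' - t * (1 - t) * nsq (y x - y x')) ->
  exists zeta, exists2 m, m0 <= m &
    (forall x, m + nsq (y x - zeta) <= J x) /\
    (forall e : R, 0 < e -> exists x, nsq (y x - zeta) < e).
Proof.
move=> J_lb J_conv; pose S := [set J x | x in [set: I]].
have infS : has_inf S by split; [exists (J i0), i0|exists m0 => _ [x _ <-]].
pose m := inf S.
have mJ x : m <= J x by apply: ge_inf; [exact: infS.2|exists x].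
have ex k : exists x, J x < m + k.+1%:R^-1.
  by have [|_ [x _ <-] ?] := @inf_adherent _ S k.+1%:R^-1 _ infS;
    [rewrite invr_gt0|exists x].
have [u uP] := choice ex.
(* Since J x'' is at least the infimum, two points that nearly minimize [J] have nearby values of
   [y]. *)
have mid x x' (t : R) : 0 < t < 1 ->
    t * (1 - t) * nsq (y x - y x') <= t * (J x - m) + (1 - t) * (J x' - m).
  move=> /[dup] /andP[t0 t1] /(J_conv x x')[x'' le].
  by have := mJ x''; lra.
have small (e : R) : 0 < e -> exists K, forall k, (K <= k)%N -> J (u k) - m < e.
  move=> e0; exists (Num.truncn e^-1) => k Kk.
  rewrite ltrBlDl; apply: lt_trans (uP k) _; rewrite ltrD2l.
  rewrite -[e]invrK ltf_pV2 ?posrE ?invr_gt0 //.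
  by apply: lt_le_trans (truncnS_gt _) _; rewrite ler_nat.
have [|zeta zP] := @nsq_complete E (y \o u).
  move=> e e0; have e4 : 0 < e / 4 by lra.
  have [K KP] := small _ e4; exists K => k Kk /=.
  have h2 : 0 < (2^-1 : R) < 1 by lra.
  have := mid (u K) (u k) _ h2; have := KP _ Kk; have := KP _ (leqnn K).
  set a := J (u K); set b := J (u k); set c := nsq _ => *; lra.
exists zeta, m; first by apply: lb_le_inf => [|_ [x _ <-]] //; exists (J i0), i0.
split; last by move=> e /zP[K KP]; exists (u K); exact: KP.
move=> x; rewrite -lerBrDl.
set d := J x - m; have d0 : 0 <= d by have := mJ x; rewrite /d; lra.
set N := nsq (y x - zeta); have N0 : 0 <= N by exact: nsq_ge0.
(* Compare x with a late term u k of the minimizing sequence. Young's inequality with weight t on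
   the cross term costs t N, hence the second factor 1 - t; the other terms become arbitrarily
   small. *)
have lim (t : R) : 0 < t < 1 -> (1 - t) ^+ 2 * N <= d.
  move=> t01; have /andP[t0 t1] := t01.
  rewrite -(ler_pM2l t0); apply/ler_addgt0Pr => e e0.
  have e3 : 0 < e / 3 by lra.
  have [K KP] := small _ e3; have [L LP] := zP _ e3.
  have kK := KP _ (leq_maxl K L); have kL := LP _ (leq_maxr K L).
  set k := maxn K L in kK kL; have := mid x (u k) _ t01.
  have -> : y x - y (u k) = (y x - zeta) - (y (u k) - zeta).
    by rewrite opprB addrA subrK.
  rewrite nsqB; have := ip_young (y x - zeta) (y (u k) - zeta) t0.
  move: kK kL; rewrite /= -/N -/d; set w := nsq _; set i := ip _ _.
  set g := _ - m => kg kw young le.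
  have w0 : 0 <= w by exact: nsq_ge0.
  have tw : t * (1 - t) * (t^-1 * w) <= e / 3.
    by rewrite mulrACA mulfV ?gt_eqF // mul1r; nra.
  have tt : 0 <= t * (1 - t) by nra.
  have := ler_wpM2l tt young; rewrite mulrDr => young'.
  have : 0 <= t * (1 - t) * w by exact: mulr_ge0.
  have : (1 - t) * g <= e / 3 by have := mJ (u k); rewrite -/g; nra.
  move: le tw young'; nra.
clearbody N d; rewrite leNgt; apply/negP => dN.
have Np : 0 < N by exact: le_lt_trans dN.
(* This t makes 2 t N = (N - d) / 2, so (1 - t)^2 N is at least (N + d) / 2 and exceeds d. *)
pose t := (N - d) / (4 * N).
have tN : 4 * (t * N) = N - d.
  by rewrite /t; field; exact: lt0r_neq0.
have t01 : 0 < t < 1.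
  apply/andP; split; first by rewrite divr_gt0 ?mulr_gt0 ?subr_gt0.
  by rewrite ltr_pdivrMr ?mulr_gt0 // mul1r; lra.
have := lim _ t01; have : 0 <= t ^+ 2 * N by rewrite mulr_ge0 ?sqr_ge0.
have -> : (1 - t) ^+ 2 * N = N - 2 * (t * N) + t ^+ 2 * N by ring.
by move: tN; move: (t * N) (t ^+ 2 * N) => p q; lra.
Qed.

(* [L] is the graph of a bounded linear functional on a subspace of [H]. *)
Lemma riesz_rel H (L : H -> R[i] -> Prop) (C : R) : L 0 0 ->
  (forall a x s x' s', L x s -> L x' s' -> L (a *: x + x') (a * s + s')) ->
  (forall x s, L x s -> 2 * complex.Re s <= C + nsq x) ->
  exists G, [/\ forall x s, L x s -> s = hdot x G, nsq G <= C &
    forall e : R, 0 < e -> exists x s, L x s /\ nsq (x - G) < e].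
Proof.
move=> L0 LZD Lb.
pose I := {p : H * R[i] | L p.1 p.2}.
(* If s = <x, G>, then J = |x - G|^2 - |G|^2, so the limit of a minimizing sequence is the
   representing vector. *)
pose J (p : I) := nsq (sval p).1 - 2 * complex.Re (sval p).2.
have LZ a x s : L x s -> L (a *: x) (a * s).
  by move=> Lx; have := LZD a _ _ _ _ Lx L0; rewrite !addr0.
have [||G [m mC [Jm appG]]] := @minimizer H I (exist _ (0, 0) L0) J
    (fun p => (sval p).1) (- C).
- by move=> [[x s] /= Lx]; have := Lb _ _ Lx; rewrite /J /=; lra.
- move=> [[x s] /= Lx] [[x' s'] /= Lx'] t t01.
  have L'' := LZD t%:C _ _ _ _ Lx (LZ (1 - t)%:C _ _ Lx').
  exists (exist _ (_, _) L''); rewrite /J /=.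
  rewrite nsq_conv ReD !Re_realM le_eqVlt; apply/orP; left; apply/eqP.
  by move: (nsq x) (nsq x') (nsq (x - x')) (complex.Re s) (complex.Re s') => *; ring.
have dm x s (Lx : L x s) : m + nsq G <= 2 * (ip x G - complex.Re s).
  by have := Jm (exist _ (x, s) Lx); rewrite /J /= nsqB; lra.
have re x s : L x s -> complex.Re s = ip x G.
  move=> Lx; set d := ip x G - complex.Re s.
  (* Along the real multiples of x a linear function of r is bounded below; unless d = 0, some r
     takes it to one less than the bound. *)
  have dr (r : R) : m + nsq G <= 2 * (r * d).
    by have := dm _ _ (LZ r%:C _ _ Lx); rewrite ipZl Re_realM -mulrBr.
  have [d0|d0] := eqVneq d 0; first by move: d0; rewrite /d; lra.
  have := dr ((m + nsq G - 1) / (2 * d)).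
  rewrite (_ : 2 * _ = m + nsq G - 1); first by lra.
  by field.
exists G; split.
- move=> x s Lx; apply: eq_Re_scaled => a.
  by rewrite (re _ _ (LZ a _ _ Lx)) /ip hdotZl.
- by have := dm _ _ L0; rewrite /ip hdot0l subrr mulr0; lra.
- by move=> e /appG[[[x s] /= Lx] lt]; exists x, s.
Qed.

End Minimization.

(** * Positive kernels and Schur products *)

Section PositiveKernels.
Context {R : realType}.
Implicit Types (E : hilbertType R).

Lemma hdot_inj E (x y : E) : (forall u, hdot x u = hdot y u) -> x = y.
Proof.
move=> xy; apply/eqP; rewrite -subr_eq0; apply/eqP/nsq_eq0.
by rewrite /nsq /ip hdotBl xy subrr.
Qed.

Lemma mulcJ a : a * conjc a = (csq a)%:C :> R[i].
Proof. by rewrite -sqr_normc -add_Re2_Im2. Qed.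

(* Schur's product theorem.  Splitting off the components along one nonzero
   vector leaves a family with fewer nonzero vectors. *)
Lemma psd_hdot_sum_ge0 E m (A : 'I_m -> 'I_m -> R[i]) :
  (forall c : 'I_m -> R[i],
     0 <= \sum_(i < m) \sum_(j < m) conjc (c i) * c j * A i j) ->
  forall eta : 'I_m -> E,
  0 <= \sum_(i < m) \sum_(j < m) A i j * hdot (eta j) (eta i).
Proof.
move=> A_ge0 eta; move: {2}(#|_|) (leqnn #|finset (fun j => eta j != 0)|) => N.
elim: N eta => [|N IH] eta.
  rewrite leqn0 cards_eq0 => /eqP eta0.
  rewrite big1 // => i _; rewrite big1 // => j _.
  have /eqP-> : eta j == 0.
    by apply/negPn/negP => nz; have := finset.in_set0 j; rewrite -eta0 finset.inE nz.
  by rewrite hdot0l mulr0.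
have [[l nz]|all0 _] := pselect (exists l, eta l != 0); last first.
  apply: IH; rewrite (_ : finset _ = finset.set0) ?cards0 //.
  apply/finset.setP => j; rewrite !finset.inE; apply/negbTE/negP => nz.
  by apply: all0; exists j.
move=> leN; pose nu := hdot (eta l) (eta l).
have nuE : nu = (nsq (eta l))%:C by exact: hdotxx.
have nu0 : 0 < nsq (eta l).
  rewrite lt_neqAle nsq_ge0 andbT eq_sym.
  by apply: contraNneq nz => /nsq_eq0 ->.
have nuN : nu != 0 by rewrite nuE; apply: contra_neq (lt0r_neq0 nu0) => /complexI.
have nuJ : conjc nu = nu by rewrite nuE conjc_real.
pose c j := hdot (eta j) (eta l).
pose eta' j := eta j - (c j / nu) *: eta l.
have split i j : hdot (eta j) (eta i) =
    hdot (eta' j) (eta' i) + nu^-1 * (conjc (c i) * c j).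
  rewrite /eta' !hdotBl !hdotBr !hdotZl !hdotZr !rmorphM /=.
  rewrite -/(c j) (hdotC (eta l) (eta i)) -/(c i) -/nu.
  rewrite conjc_inv nuJ; move: (conjc (c i)) (c j) (hdot (eta j) (eta i)) => a b d.
  by field.
have -> : \sum_(i < m) \sum_(j < m) A i j * hdot (eta j) (eta i) =
    (\sum_(i < m) \sum_(j < m) A i j * hdot (eta' j) (eta' i)) +
    nu^-1 * \sum_(i < m) \sum_(j < m) conjc (c i) * c j * A i j.
  rewrite mulr_sumr -big_split; apply: eq_bigr => i _ /=.
  rewrite mulr_sumr -big_split; apply: eq_bigr => j _ /=.
  by rewrite split mulrDr; congr (_ + _); ring.
rewrite addr_ge0 // ?mulr_ge0 // ?invr_ge0 ?nuE ?ler0c ?nsq_ge0 //.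
apply: IH; rewrite -ltnS (leq_trans _ leN) // proper_card //.
apply/fintype.properP; split.
  apply/fintype.subsetP => j; rewrite !finset.inE; apply: contra_neq => j0.
  by rewrite /eta' /c j0 hdot0l mul0r scale0r subrr.
exists l; rewrite !finset.inE ?nz //; apply/negPn/eqP.
by rewrite /eta' /c -/nu mulfV // scale1r subrr.
Qed.

Lemma psd_kernel_vec n (k : unit_ball R n -> unit_ball R n -> R[i]) E
    (s : seq (unit_ball R n * E)) : psd_kernel k ->
  0 <= \sum_(q <- s) \sum_(p <- s) k q.1 p.1 * hdot p.2 q.2.
Proof.
move=> k_psd; rewrite big_tnth.
under eq_bigr => i _ do rewrite big_tnth.
apply: (@psd_hdot_sum_ge0 E (size s)
  (fun i j => k (tnth (in_tuple s) i).1 (tnth (in_tuple s) j).1) _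
  (fun i => (tnth (in_tuple s) i).2)) => c.
exact: (k_psd _ (fun i => (tnth (in_tuple s) i).1)).
Qed.

Definition ballsq n (w : unit_ball R n) : R := \sum_(i < n) csq (crd w i).

Lemma ballsq_lt1 n (w : unit_ball R n) : ballsq w < 1.
Proof.
rewrite -ltcR rmorph_sum /= (_ : 1%:C = 1) //.
apply: le_lt_trans (svalP w); rewrite le_eqVlt; apply/orP; left; apply/eqP.
by apply: eq_bigr => i _; rewrite -add_Re2_Im2.
Qed.

Definition ball_dot n (z w : unit_ball R n) : R[i] :=
  \sum_(i < n) crd z i * conjc (crd w i).

Lemma da_kernelE n (z w : unit_ball R n) : da_kernel n z w = (1 - ball_dot z w)^-1.
Proof. by []. Qed.

Lemma ball_dotxx n (w : unit_ball R n) : ball_dot w w = (ballsq w)%:C.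
Proof. by rewrite rmorph_sum; apply: eq_bigr => i _; rewrite mulcJ. Qed.

(** From 2 Re (z_i conj(w_i)) <= |z_i|^2 + |w_i|^2, the real part of <z, w> is at most the mean of
    |z|^2 and |w|^2, hence less than 1. *)
Lemma ball_dot_neq1 n (z w : unit_ball R n) : 1 - ball_dot z w != 0.
Proof.
suff : complex.Re (1 - ball_dot z w) != 0 by apply: contra_neq => ->.
rewrite ReD ReN Re_sum gt_eqF // subr_gt0.
apply: le_lt_trans (_ : 2^-1 * (ballsq z + ballsq w) < 1); last first.
  by have := ballsq_lt1 z; have := ballsq_lt1 w; rewrite /=; lra.
rewrite /ballsq -big_split mulr_sumr; apply: ler_sum => i _ /=.
case: (crd z i) (crd w i) => a b [c d]; rewrite /csq /=.
by have := sqr_ge0 (a - c); have := sqr_ge0 (b - d); nra.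
Qed.

Lemma da_kernelV n (z w : unit_ball R n) : da_kernel n z w * (1 - ball_dot z w) = 1.
Proof. by rewrite da_kernelE mulVf ?ball_dot_neq1. Qed.

Lemma zero_in_ball n : \sum_(i < n) `|(0 : 'rV[R[i]]_n) 0 i| ^+ 2 < 1.
Proof. by rewrite big1 // => i _; rewrite mxE normr0 expr0n. Qed.

Definition ball0 n : unit_ball R n := 
  exist (fun z : 'rV[R[i]]_n => is_true (\sum_(i < n) `|z 0 i| ^+ 2 < 1)) 0
    (zero_in_ball n).

Lemma crd_ball0 n i : crd (ball0 n) i = 0. Proof. by rewrite /crd mxE. Qed.

Lemma da_kernel0 n (z : unit_ball R n) : da_kernel n z (ball0 n) = 1.
Proof.
rewrite da_kernelE /ball_dot big1 ?subr0 ?invr1 // => i _.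
by rewrite crd_ball0 conjc0 mulr0.
Qed.

(** Positivity of k (1 - <z, w>), which makes the coordinate shifts of the space of k a row
    contraction. *)
Definition da_divides n (k : unit_ball R n -> unit_ball R n -> R[i]) : Prop :=
  exists2 k', psd_kernel k' & forall z w, k z w = da_kernel n z w * k' z w.

(** The quotient is the constant kernel 1, whose quadratic form is |sum_i c_i|^2. *)
Lemma da_divides_da n : da_divides (da_kernel n).
Proof.
exists (fun _ _ => 1) => [m z c|z w]; last by rewrite mulr1.
have -> : \sum_(i < m) \sum_(j < m) conjc (c i) * c j * 1 =
    (\sum_(i < m) c i) * conjc (\sum_(i < m) c i).
  rewrite rmorph_sum mulr_sumr; apply: eq_bigr => i _.
  by rewrite mulr_suml; apply: eq_bigr => j _; rewrite mulr1 mulrC.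
exact: mulcJ_ge0.
Qed.

End PositiveKernels.

(** * Kernel vectors, coordinate shifts and their adjoints *)

Section KernelVectors.
Context {R : realType} {n : nat} {k : unit_ball R n -> unit_ball R n -> R[i]}.
Context {E : hilbertType R} (H : rkhs k E).
Implicit Types (F G : H) (w z : unit_ball R n) (eta : E).

Definition kvec w eta : H := s2val (cid2 (rk_reproducing H w eta)).

Lemma rk_eval_kvec z w eta : rk_eval H z (kvec w eta) = k z w *: eta.
Proof. exact: (s2valP (cid2 (rk_reproducing H w eta))). Qed.

Lemma hdot_kvec F w eta : hdot F (kvec w eta) = hdot (rk_eval H w F) eta.
Proof. exact: (s2valP' (cid2 (rk_reproducing H w eta))). Qed.

Lemma kvecZ a w eta : kvec w (a *: eta) = a *: kvec w eta.
Proof.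
apply: (@rk_eval_inj _ _ _ _ H) => z.
by rewrite linearZ_LR !rk_eval_kvec !scalerA mulrC.
Qed.

Lemma hdot_kvecs z w eta eta' :
  hdot (kvec w eta) (kvec z eta') = k z w * hdot eta eta'.
Proof. by rewrite hdot_kvec rk_eval_kvec hdotZl. Qed.

Lemma ip_kvec F w eta : ip F (kvec w eta) = ip (rk_eval H w F) eta.
Proof. by rewrite /ip hdot_kvec. Qed.

Lemma nsq_kvec w eta : nsq (kvec w eta) = complex.Re (k w w) * nsq eta.
Proof.
by rewrite /nsq /ip hdot_kvecs hdotxx mulrC Re_realM mulrC.
Qed.

Section Shift.
Hypothesis k_div : da_divides k.

(** The function sum_i z_i F_i comes from Riesz representation. On a combination g of kernel vectors
    its functional is sum_i <h_i, F_i>, where h_i is what the adjoint of multiplication by z_i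
    should make of g. *)
Lemma row_mul_exists (F : 'I_n -> H) : exists G,
  (forall w, rk_eval H w G = \sum_(i < n) crd w i *: rk_eval H w (F i)) /\
  nsq G <= \sum_(i < n) nsq (F i).
Proof.
have [k' k'_psd kE] := k_div.
pose g (t : seq (unit_ball R n * E)) := \sum_(p <- t) kvec p.1 p.2.
pose h (t : seq (unit_ball R n * E)) (i : 'I_n) :=
  \sum_(p <- t) conjc (crd p.1 i) *: kvec p.1 p.2.
pose phi t := \sum_(i < n) hdot (h t i) (F i).
have hg t : \sum_(i < n) nsq (h t i) <= nsq (g t).
  rewrite -lecR rmorph_sum /= -hdotxx; under eq_bigr do rewrite -hdotxx.
  (* The difference is the form of k (1 - <z, w>) = k' multiplied entrywise by the Gram matrix of
     the vectors. *)
  rewrite -subr_ge0 (_ : _ - _ =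
    \sum_(q <- t) \sum_(p <- t) k' q.1 p.1 * hdot p.2 q.2); last first.
    have gE : hdot (g t) (g t) =
        \sum_(q <- t) \sum_(p <- t) hdot (kvec p.1 p.2) (kvec q.1 q.2).
      by rewrite hdot_sumr; apply: eq_bigr => q _; rewrite hdot_suml.
    have hE i : hdot (h t i) (h t i) = \sum_(q <- t) \sum_(p <- t)
        crd q.1 i * conjc (crd p.1 i) * hdot (kvec p.1 p.2) (kvec q.1 q.2).
      rewrite hdot_sumr; apply: eq_bigr => q _; rewrite hdot_suml.
      apply: eq_bigr => p _; rewrite hdotZl hdotZr.
      by rewrite (_ : conjc (conjc _) = crd q.1 i) ?mulrA ?[conjc _ * _]mulrC //;
        case: (crd q.1 i) => ? ? /=; rewrite opprK.
    rewrite gE; under [X in _ - X]eq_bigr do rewrite hE.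
    rewrite [X in _ - X]exchange_big -sumrB; apply: eq_bigr => q _ /=.
    rewrite [X in _ - X]exchange_big -sumrB; apply: eq_bigr => p _ /=.
    rewrite -mulr_suml -/(ball_dot q.1 p.1) hdot_kvecs kE.
    rewrite -[RHS]mul1r -(da_kernelV q.1 p.1).
    by move: (da_kernel _ _ _) (ball_dot _ _) (k' _ _) (hdot _ _) => *; ring.
  exact: psd_kernel_vec.
(* [phi] is defined on lists; that its value depends only on the vector [g t] is part of the
   conclusion of [riesz_rel]. *)
have [|||G [GE GF _]] := @riesz_rel R H
  (fun x s => exists2 t, x = g t & s = phi t) (\sum_(i < n) nsq (F i)).
- exists [::]; first by rewrite /g big_nil.
  by rewrite /phi big1 // => i _; rewrite /h big_nil hdot0l.
- move=> a _ _ _ _ [t -> ->] [t' -> ->].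
  exists ([seq (p.1, a *: p.2) | p <- t] ++ t').
    rewrite /g big_cat big_map scaler_sumr; congr (_ + _).
    by apply: eq_bigr => p _; rewrite kvecZ.
  rewrite /phi mulr_sumr -big_split; apply: eq_bigr => i _ /=.
  rewrite -hdotZl -hdotDl; congr (hdot _ (F i)).
  rewrite /h big_cat big_map scaler_sumr; congr (_ + _).
  by apply: eq_bigr => p _; rewrite /= kvecZ !scalerA mulrC.
- move=> _ _ [t -> ->]; rewrite /phi Re_sum mulr_sumr.
  apply: le_trans (_ : \sum_(i < n) (nsq (F i) + nsq (h t i)) <= _).
    apply: ler_sum => i _; have := ip_young (h t i) (F i) (@ltr01 R).
    by rewrite invr1 !mul1r addrC.
  by rewrite big_split lerD2l.
exists G; split=> // w; apply: hdot_inj => eta.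
rewrite -hdot_kvec hdotC -(GE _ (phi [:: (w, eta)])); last first.
  by exists [:: (w, eta)]; rewrite // /g big_seq1.
rewrite /phi rmorph_sum hdot_suml; apply: eq_bigr => i _.
by rewrite /h big_seq1 /= -hdotC hdotZr hdotZl hdot_kvec conjcK.
Qed.

(** A row whose only nonzero entry is F shows that z_i F exists, so [mul_op] does not return its
    default value. *)
Lemma rk_eval_shift i F w : rk_eval H w (coord_shift H i F) = crd w i *: rk_eval H w F.
Proof.
have [G [GE _]] := row_mul_exists (fun j => if j == i then F else 0).
rewrite /coord_shift /mul_op; case: xgetP => [_ -> /(_ w) //|/(_ G) []] z.
rewrite GE (bigD1 i) //= eqxx big1 ?addr0 // => j /negbTE->.
by rewrite linear0 scaler0.
Qed.

Lemma shiftP i a F G :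
  coord_shift H i (a *: F + G) = a *: coord_shift H i F + coord_shift H i G.
Proof.
apply: (@rk_eval_inj _ _ _ _ H) => w.
by rewrite linearP !rk_eval_shift linearP scalerDr !scalerA mulrC.
Qed.

Lemma nsq_shift_row (F : 'I_n -> H) :
  nsq (\sum_(i < n) coord_shift H i (F i)) <= \sum_(i < n) nsq (F i).
Proof.
have [G [GE Gle]] := row_mul_exists F.
rewrite (_ : \sum_i _ = G) //; apply: (@rk_eval_inj _ _ _ _ H) => w.
by rewrite GE linear_sum; apply: eq_bigr => i _; rewrite rk_eval_shift.
Qed.

Lemma shift0 i : coord_shift H i 0 = 0.
Proof.
by apply: (@rk_eval_inj _ _ _ _ H) => w; rewrite rk_eval_shift linear0 scaler0.
Qed.

Lemma nsq_shift i F : nsq (coord_shift H i F) <= nsq F.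
Proof.
have := nsq_shift_row (fun j => if j == i then F else 0).
rewrite (bigD1 i) //= eqxx big1 ?addr0; last by move=> j /negbTE->; exact: shift0.
by rewrite (bigD1 i) //= eqxx big1 ?addr0 // => j /negbTE->; exact: nsq0.
Qed.

Definition bshift i : H -> H := adjoint (coord_shift H i).

(** The functional F |-> <z_i F, G> is bounded, so Riesz representation supplies the vector sought
    by [adjoint]. *)
Lemma hdot_shift i F G : hdot (coord_shift H i F) G = hdot F (bshift i G).
Proof.
rewrite /bshift /adjoint; case: xgetP => [_ -> /(_ F) //|none].
have [|||x [xE _ _]] := @riesz_rel R H
  (fun x s => s = hdot (coord_shift H i x) G) (nsq G).
- by rewrite shift0 hdot0l.
- by move=> a x _ x' _ -> ->; rewrite shiftP hdotDl hdotZl.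
- move=> x _ ->; have := ip_young (coord_shift H i x) G (@ltr01 R).
  by rewrite invr1 !mul1r addrC => /le_trans; apply; rewrite lerD2l nsq_shift.
by case: (none x) => u; exact: xE.
Qed.

Lemma hdot_bshift i F G : hdot (bshift i F) G = hdot F (coord_shift H i G).
Proof. by rewrite hdotC -hdot_shift -hdotC. Qed.

Lemma bshiftP i a F G : bshift i (a *: F + G) = a *: bshift i F + bshift i G.
Proof.
by apply: hdot_inj => u; rewrite hdotDl hdotZl !hdot_bshift hdotDl hdotZl.
Qed.

(** The eigenvalue depends on w alone, so a pair of kernel vectors at w in two spaces spans an
    invariant line. *)
Lemma bshift_kvec i w eta : bshift i (kvec w eta) = conjc (crd w i) *: kvec w eta.
Proof.
apply: hdot_inj => u; rewrite hdot_bshift hdotZl hdotC [in RHS]hdotC.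
by rewrite !hdot_kvec rk_eval_shift hdotZl rmorphM.
Qed.

(** With G the row applied to the adjoint shifts of F, <G, F> = s and |G|^2 <= s, so that 2 s <= s +
    |F|^2. *)
Lemma nsq_bshift_col F : \sum_(i < n) nsq (bshift i F) <= nsq F.
Proof.
have := nsq_shift_row (fun i => bshift i F).
set s := \sum_i nsq _; set G := \sum_i coord_shift _ _ _ => Gs.
have : ip G F = s.
  by rewrite ip_suml; apply: eq_bigr => i _; rewrite /ip hdot_shift.
have := ip_young G F (@ltr01 R); rewrite invr1 !mul1r; lra.
Qed.

End Shift.
End KernelVectors.

Arguments kvec {R n k E} H w eta.
Arguments bshift {R n k E} H i F.

(** * Identities of the Drury-Arveson space *)

Section DruryArveson.
Context {R : realType} {n : nat} {E : hilbertType R} (H : rkhs (@da_kernel R n) E).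
Implicit Types (F : H).
Let k_div := @da_divides_da R n.

(** This is k_1(z, w) = 1 + <z, w> k_1(z, w), read on kernel vectors. *)
Lemma kvec_da_decomp (w : unit_ball R n) (eta : E) :
  kvec H w eta = kvec H (ball0 n) eta +
    \sum_(i < n) conjc (crd w i) *: coord_shift H i (kvec H w eta).
Proof.
apply: (@rk_eval_inj _ _ _ _ H) => z; rewrite linearD linear_sum /=.
under eq_bigr do rewrite linearZ_LR rk_eval_shift // rk_eval_kvec !scalerA ?mulrA.
rewrite !rk_eval_kvec -scaler_suml -scalerDl da_kernel0; congr (_ *: _).
rewrite -mulr_suml (_ : \sum_i _ = ball_dot z w); last first.
  by apply: eq_bigr => i _; rewrite mulrC.
by have := da_kernelV z w; rewrite mulrBr mulr1 => /eqP; rewrite subr_eq mulrC => /eqP.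
Qed.

(** Testing on kernel vectors gives F = F(0) + sum_i z_i (S_i F), with S_i the adjoint shifts; pair
    this with F. *)
Lemma nsq_da F :
  nsq F = nsq (rk_eval H (ball0 n) F) + \sum_(i < n) nsq (bshift H i F).
Proof.
pose F0 := kvec H (ball0 n) (rk_eval H (ball0 n) F).
have FE : F = F0 + \sum_(i < n) coord_shift H i (bshift H i F).
  apply: (@rk_eval_inj _ _ _ _ H) => w; apply: hdot_inj => eta.
  rewrite -!hdot_kvec hdotDl hdot_suml [in LHS]kvec_da_decomp hdotDr hdot_sumr.
  congr (_ + _); first by rewrite /F0 hdot_kvecs da_kernel0 hdot_kvec mul1r.
  apply: eq_bigr => i _.
  by rewrite hdot_shift // bshift_kvec // !hdotZr hdot_bshift.
rewrite [in LHS]/nsq {1}FE ipDl ip_suml; congr (_ + _).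
  by rewrite ipC /ip /F0 hdot_kvec.
by apply: eq_bigr => i _; rewrite /ip hdot_shift.
Qed.

(* With [U] the adjoint of multiplication by [1 - <z, w>], [U^* k_w = k_0]. *)
Lemma rk_eval_da_adjoint (w : unit_ball R n) F :
  rk_eval H w (F - \sum_(i < n) crd w i *: bshift H i F) = rk_eval H (ball0 n) F.
Proof.
apply: hdot_inj => eta; rewrite -!hdot_kvec hdotBl hdot_suml.
rewrite {1}kvec_da_decomp hdotDr hdot_sumr.
rewrite [X in _ - X](_ : _ = \sum_(i < n)
    hdot F (conjc (crd w i) *: coord_shift H i (kvec H w eta))) ?addrK //.
apply: eq_bigr => i _; rewrite hdotZl hdotZr hdot_bshift //; congr (_ * _).
by case: (crd w i) => ? ? /=; rewrite opprK.
Qed.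

Lemma nsq_kvec_da (w : unit_ball R n) (eta : E) :
  nsq (kvec H w eta) = (1 - ballsq w)^-1 * nsq eta.
Proof.
by rewrite nsq_kvec da_kernelE ball_dotxx -[X in X - _]/(1%:C) -rmorphB -fmorphV.
Qed.

End DruryArveson.

(** * Consequences of a linearity law *)

Section LinearLaw.
Context {R : realType} {U V : lmodType R[i]} (f : U -> V).
Hypothesis fP : forall a x y, f (a *: x + y) = a *: f x + f y.

Lemma law0 : f 0 = 0.
Proof. by have := fP (-1) 0 0; rewrite scaler0 addr0 scaleN1r addNr. Qed.

Lemma lawZ a x : f (a *: x) = a *: f x.
Proof. by rewrite -[a *: x]addr0 fP law0 addr0. Qed.

Lemma lawD x y : f (x + y) = f x + f y.
Proof. by rewrite -[x in LHS]scale1r fP scale1r. Qed.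

Lemma lawB x y : f (x - y) = f x - f y.
Proof. by rewrite lawD -scaleN1r lawZ scaleN1r. Qed.

End LinearLaw.

(** * Backward shifts localized at a point of the ball *)

Section PointwiseDefect.
Context {R : realType} {n : nat} {k : unit_ball R n -> unit_ball R n -> R[i]}.
Context {E : hilbertType R} (H : rkhs k E) (k_div : da_divides k).
Context (w : unit_ball R n).
Implicit Types (F G : H) (a : R[i]).

(** [point_res] is the adjoint of multiplication by 1 - <z, w>, and [point_defect i] annihilates the
    kernel vectors at w. *)
Definition point_comb F : H := \sum_(i < n) crd w i *: bshift H i F.
Definition point_res F : H := F - point_comb F.
Definition point_defect i F : H := bshift H i F - conjc (crd w i) *: F.
Definition point_defect_comb F : H := \sum_(i < n) crd w i *: point_defect i F.

Lemma point_combP a F G : point_comb (a *: F + G) = a *: point_comb F + point_comb G.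
Proof.
rewrite /point_comb scaler_sumr -big_split; apply: eq_bigr => i _ /=.
by rewrite bshiftP // scalerDr !scalerA mulrC.
Qed.

Lemma point_resP a F G : point_res (a *: F + G) = a *: point_res F + point_res G.
Proof. by rewrite /point_res point_combP opprD addrACA scalerBr. Qed.

Lemma point_resD F G : point_res (F + G) = point_res F + point_res G.
Proof. exact: (lawD point_resP). Qed.

Lemma point_resB F G : point_res (F - G) = point_res F - point_res G.
Proof. exact: (lawB point_resP). Qed.

Lemma point_resZ a F : point_res (a *: F) = a *: point_res F.
Proof. exact: (lawZ point_resP). Qed.

Lemma point_defect_combE F :
  point_defect_comb F = point_comb F - (ballsq w)%:C *: F.
Proof.
rewrite /point_defect_comb; under eq_bigr do rewrite scalerBr scalerA mulcJ.
by rewrite sumrB -scaler_suml -rmorph_sum.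
Qed.

Lemma point_comb_kvec eta :
  point_comb (kvec H w eta) = (ballsq w)%:C *: kvec H w eta.
Proof.
rewrite /point_comb; under eq_bigr do rewrite bshift_kvec // scalerA mulcJ.
by rewrite -scaler_suml -rmorph_sum.
Qed.

Lemma point_res_kvec eta :
  point_res (kvec H w eta) = (1 - ballsq w)%:C *: kvec H w eta.
Proof. by rewrite /point_res point_comb_kvec rmorphB scalerBl scale1r. Qed.

Lemma point_defectD_kvec i F eta :
  point_defect i (F + kvec H w eta) = point_defect i F.
Proof.
rewrite /point_defect -[F in LHS]scale1r bshiftP // !scale1r bshift_kvec //.
by rewrite scalerDr opprD addrACA subrr addr0.
Qed.

Lemma point_defect_combD_kvec F eta :
  point_defect_comb (F + kvec H w eta) = point_defect_comb F.
Proof. by apply: eq_bigr => i _; rewrite point_defectD_kvec. Qed.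

(* Complete the square in [nsq F - \sum_i nsq (bshift i F)] after substituting
   [bshift i F = point_defect i F + conjc w_i F]. *)
Lemma nsq_point_res F :
  nsq (point_res F) =
  (1 - ballsq w) * (nsq F - \sum_(i < n) nsq (bshift H i F)) +
  nsq (point_defect_comb F) +
  (1 - ballsq w) * \sum_(i < n) nsq (point_defect i F).
Proof.
have -> : \sum_(i < n) nsq (point_defect i F) =
    \sum_(i < n) nsq (bshift H i F) - 2 * ip (point_comb F) F + ballsq w * nsq F.
  rewrite /point_comb ip_suml mulr_sumr /ballsq mulr_suml -sumrB -big_split.
  by apply: eq_bigr => i _ /=; rewrite nsqB nsqZ csqJ ipZJ.
rewrite point_defect_combE /point_res !nsqB nsqZ ipZr (ipC F) /csq /= expr0n addr0.
move: (nsq F) (nsq (point_comb F)) (ip _ _) (ballsq w) (\sum_i _) => *; ring.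
Qed.

(** Young's inequality with weight r = (1 + |w|^2) / 2, which is at least |w|^2, less than 1, and
    still positive at w = 0. *)
Lemma nsq_point_comb F : nsq (point_comb F) <= (1 + ballsq w) / 2 * nsq F.
Proof.
set r := _ / 2; have r1 := ballsq_lt1 w.
have r0 : 0 <= ballsq w by apply: sumr_ge0 => i _; exact: csq_ge0.
have rp : 0 < r by rewrite /r; lra.
have : 2 * nsq (point_comb F) <=
    \sum_(i < n) (r * nsq (bshift H i F) + r^-1 * (csq (crd w i) * nsq (point_comb F))).
  rewrite {1}/nsq {1}/point_comb ip_suml mulr_sumr; apply: ler_sum => i _.
  by rewrite ipZJ -csqJ -nsqZ ip_young.
rewrite big_split -!mulr_sumr -mulr_suml -/(ballsq w) mulrA /=.
have : r^-1 * ballsq w <= 1 by rewrite ler_pdivrMl // mulr1 /r; lra.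
have := nsq_bshift_col k_div F; have := nsq_ge0 (point_comb F).
move: (nsq (point_comb F)) (nsq F) (\sum_i _) (r^-1 * _) => N M S q.
move: r rp => r rp *; nra.
Qed.

End PointwiseDefect.

Lemma rk_eval_point_res {R : realType} {n : nat} {E : hilbertType R}
    (H : rkhs (@da_kernel R n) E) (w : unit_ball R n) (F : H) :
  rk_eval H w (point_res w F) = rk_eval H (ball0 n) F.
Proof. exact: rk_eval_da_adjoint. Qed.

Lemma geometric_vanishing {R : realType} (r M e : R) :
  0 <= r < 1 -> 0 < e -> exists N, r ^+ N * M < e.
Proof.
move=> /andP[r0 r1] e0; have r1' : `|r| < 1 by rewrite ger0_norm.
have e1 : 0 < e / (1 + `|M|) by rewrite divr_gt0 // ltr_pwDl.
have /cvgrPdist_lt/(_ _ e1)[N _ /(_ N (leqnn N))] := cvg_expr r1'.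
rewrite sub0r normrN ltr_pdivlMr ?ltr_pwDl // => lt; exists N.
apply: le_lt_trans lt; rewrite ger0_norm ?exprn_ge0 //.
apply: ler_wpM2l; first exact: exprn_ge0.
by have := ler_norm M; lra.
Qed.

(** * Adjoining one kernel vector to a contraction graph *)

Section Extension.
Context {R : realType} {n : nat} {k : unit_ball R n -> unit_ball R n -> R[i]}.
Context {E1 E2 : hilbertType R}.
Context (H1 : rkhs (@da_kernel R n) E1) (H2 : rkhs k E2).
Context (k_div : da_divides k).
Implicit Types (G : set (H2 * H1)) (g : H2) (f : H1) (a : R[i]).
Let da_div := @da_divides_da R n.

(* Graphs of the contractions from co-invariant subspaces of [H2] to [H1] that
   intertwine the backward shifts. *)
Definition coinv_contraction G : Prop :=
  [/\ G (0, 0),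
      forall a g f g' f', G (g, f) -> G (g', f') -> G (a *: g + g', a *: f + f'),
      forall g f, G (g, f) -> nsq f <= nsq g &
      forall i g f, G (g, f) -> G (bshift H2 i g, bshift H1 i f)].

Section OnePoint.
Variables (G : set (H2 * H1)) (GP : coinv_contraction G).
Variables (w : unit_ball R n) (eta : E2).
Let v := kvec H2 w eta.
Let c := 1 - ballsq w.

Lemma graphZ a g f : G (g, f) -> G (a *: g, a *: f).
Proof.
have [G0 Glin _ _] := GP => Gx.
by have := Glin a _ _ _ _ Gx G0; rewrite !addr0.
Qed.

Lemma graphD g f g' f' : G (g, f) -> G (g', f') -> G (g + g', f + f').
Proof.
have [_ Glin _ _] := GP => Gx Gy.
by have := Glin 1 _ _ _ _ Gx Gy; rewrite !scale1r.
Qed.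

Lemma graphB g f g' f' : G (g, f) -> G (g', f') -> G (g - g', f - f').
Proof. by move=> Gx Gy; have := graphD Gx (graphZ (-1) Gy); rewrite !scaleN1r. Qed.

Lemma graph_sum (x : 'I_n -> H2) (y : 'I_n -> H1) :
  (forall i, G (x i, y i)) -> G (\sum_(i < n) x i, \sum_(i < n) y i).
Proof.
have [G0 _ _ _] := GP => Gxy.
by apply: (big_ind2 (fun p q => G (p, q))) => // *; exact: graphD.
Qed.

Lemma graph_comb g f : G (g, f) -> G (point_comb w g, point_comb w f).
Proof.
have [_ _ _ Ginv] := GP.
by move=> Gx; apply: graph_sum => i; apply/graphZ/Ginv.
Qed.

Lemma graph_res g f : G (g, f) -> G (point_res w g, point_res w f).
Proof. by move=> Gx; apply/graphB/graph_comb. Qed.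

Lemma graph_defect i g f : G (g, f) -> G (point_defect w i g, point_defect w i f).
Proof. by have [_ _ _ Ginv] := GP => Gx; apply/graphB; [exact: Ginv|exact: graphZ]. Qed.

Lemma graph_defect_comb g f :
  G (g, f) -> G (point_defect_comb w g, point_defect_comb w f).
Proof. by move=> Gx; apply: graph_sum => i; apply/graphZ/graph_defect. Qed.

Lemma c_gt0 : 0 < c.
Proof. by rewrite subr_gt0 ballsq_lt1. Qed.

(** Expand both sides by [nsq_point_res]. The defects of g + v are those of g, and they dominate
    those of f because [G] is invariant and contractive. The inequality says that [J] below is
    nonnegative. *)
Lemma nsq_res_kvec_ge g f : G (g, f) ->
  nsq (point_res w f) - c * nsq (rk_eval H1 (ball0 n) f) <=
  nsq (point_res w g + c%:C *: v).
Proof.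
have [_ _ Gle _] := GP => Gx; have c0 := c_gt0.
have -> : point_res w g + c%:C *: v = point_res w (g + v).
  by rewrite -[g in RHS]scale1r point_resP // scale1r point_res_kvec.
rewrite !nsq_point_res // -/c point_defect_combD_kvec //.
have -> : \sum_(i < n) nsq (point_defect w i (g + v)) =
    \sum_(i < n) nsq (point_defect w i g).
  by apply: eq_bigr => i _; rewrite point_defectD_kvec.
rewrite [nsq f]nsq_da addrK.
have h1 := Gle _ _ (graph_defect_comb Gx).
have h2 : \sum_(i < n) nsq (point_defect w i f) <= \sum_(i < n) nsq (point_defect w i g).
  by apply: ler_sum => i _; exact/Gle/graph_defect.
have h3 : 0 <= nsq (g + v) - \sum_(i < n) nsq (bshift H2 i (g + v)).
  by rewrite subr_ge0 nsq_bshift_col.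
have := ler_wpM2l (ltW c0) h2; have := mulr_ge0 (ltW c0) h3; lra.
Qed.

(** Since (U f)(w) = f(0) and |K_w zeta|^2 = |zeta|^2 / c, expanding the left side and dividing by c
    turns the claim into |f(0) + zeta|^2 <= J(g, f). Minimizing [J] yields such a zeta. *)
Lemma one_point_shifted : exists zeta : E1, forall g f, G (g, f) ->
  nsq (point_res w f + c%:C *: kvec H1 w zeta) <= nsq (point_res w g + c%:C *: v).
Proof.
have [G0 Glin Gle _] := GP; have c0 := c_gt0.
pose ev0 f := rk_eval H1 (ball0 n) f.
pose I := {p : H2 * H1 | G p}.
pose J (p : I) := c^-1 * (nsq (point_res w (sval p).1 + c%:C *: v) -
  nsq (point_res w (sval p).2)) + nsq (ev0 (sval p).2).
have [||z [m m0 [mJ _]]] := @minimizer R E1 I (exist _ (0, 0) G0) J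
    (fun p => ev0 (sval p).2) 0.
- move=> [[g f] /= Gx]; rewrite /J /= -(ler_pM2l c0) mulr0 mulrDr mulrA.
  by rewrite mulfV ?gt_eqF // mul1r; have := nsq_res_kvec_ge Gx; rewrite /ev0; lra.
- move=> [[g f] /= Gx] [[g' f'] /= Gx'] t t01.
  have Gt := Glin t%:C _ _ _ _ Gx (graphZ (1 - t)%:C Gx').
  exists (exist _ (_, _) Gt); rewrite /J /=.
  (* Splitting the constant vector convexly makes U g + c v affine along the segment, so [nsq_conv]
     applies to every term. *)
  have cE : c%:C *: v = t%:C *: (c%:C *: v) + (1 - t)%:C *: (c%:C *: v).
    by rewrite -scalerDl -rmorphD addrC subrK scale1r.
  rewrite !point_resD // !point_resZ // [in X in X <= _]cE addrACA -!scalerDr.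
  rewrite !nsq_conv opprD addrACA subrr addr0 -!point_resB //.
  have -> : ev0 (t%:C *: f + (1 - t)%:C *: f') =
      t%:C *: ev0 f + (1 - t)%:C *: ev0 f' by rewrite /ev0 linearD !linearZ_LR.
  rewrite nsq_conv.
  (* Contractivity on the image of the difference under U: the leading part of [J] dominates |f(0) -
     f'(0)|^2. *)
  have := Gle _ _ (graph_res (graphB Gx Gx')).
  have : 0 <= t * (1 - t) * c^-1.
    have /andP[/ltW t0 /ltW t1] := t01; rewrite !mulr_ge0 ?subr_ge0 //.
    by rewrite invr_ge0 ltW.
  move: (c^-1) (nsq _) (nsq _) (nsq _) (nsq _) (nsq _) (nsq _) => d a1 a2 a3 a4 a5 a6.
  move=> p0 /(ler_wpM2l p0) h; rewrite -subr_ge0 in h.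
  rewrite -subr_ge0; move: (nsq _) (nsq _) (nsq _) => b1 b2 b3; apply: le_trans h _.
  by rewrite le_eqVlt; apply/orP; left; apply/eqP; ring.
have kN : kvec H1 w (- z) = - kvec H1 w z by rewrite -scaleN1r kvecZ scaleN1r.
exists (- z) => g f Gx; have := mJ (exist _ (g, f) Gx); rewrite /J /= => le.
rewrite kN scalerN nsqB ipZr ip_kvec rk_eval_point_res.
rewrite nsqZ nsq_kvec_da -/c -/(ev0 f) csq_real.
have {le} le : nsq (ev0 f) - 2 * ip (ev0 f) z + nsq z <=
    c^-1 * (nsq (point_res w g + c%:C *: v) - nsq (point_res w f)) + nsq (ev0 f).
  by rewrite -nsqB; apply: le_trans le; rewrite lerDr.
have := ler_wpM2l (ltW c0) le; rewrite !mulrDr !mulrA mulfV ?gt_eqF //.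
rewrite mul1r expr2 -[c * c * _]mulrA mulfV ?gt_eqF //.
move: (nsq _) (nsq _) (nsq _) (nsq _) (ip _ _) => *; lra.
Qed.

(** For a != 0, apply the case of coefficient c to (c / a) (g, f) and use homogeneity; a = 0 is
    contractivity of [G]. *)
Lemma one_point_scaled : exists zeta : E1, forall g f a, G (g, f) ->
  nsq (point_res w f + a *: kvec H1 w zeta) <= nsq (point_res w g + a *: v).
Proof.
have [_ _ Gle _] := GP; have [zeta zP] := one_point_shifted.
exists zeta => g f a Gx; have [->|a0] := eqVneq a 0.
  by rewrite !scale0r !addr0; exact/Gle/graph_res.
have c0 : c%:C != 0 by apply: contra_neq (lt0r_neq0 c_gt0) => /complexI.
have e (V : lmodType R[i]) (x y : V) :
    (c%:C / a) *: x + c%:C *: y = (c%:C / a) *: (x + a *: y).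
  by rewrite scalerDr scalerA divfK.
have := zP _ _ (graphZ (c%:C / a) Gx); rewrite !point_resZ // !e !nsqZ.
rewrite ler_pM2l // lt_neqAle csq_ge0 andbT eq_sym.
apply: contra_neq (mulf_neq0 c0 (invr_neq0 a0)); exact: csq_eq0.
Qed.

(** A truncated Neumann series for the inverse of U = 1 - B, with B = [point_comb w]: g1 is the sum
    of B^j g over j < N, and g2 = B^N g. *)
Lemma graph_neumann N g f : G (g, f) -> exists g1 f1 g2 f2,
  [/\ G (g1, f1) /\ G (g2, f2), g = point_res w g1 + g2, f = point_res w f1 + f2 &
      nsq g2 <= ((1 + ballsq w) / 2) ^+ N * nsq g].
Proof.
have [G0 _ _ _] := GP; move=> Gx; elim: N => [|N [g1 [f1 [g2 [f2 [[G1 G2] gE fE le]]]]]].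
  exists 0, 0, g, f; split=> //; last by rewrite expr0 mul1r.
    by rewrite (law0 (point_resP k_div w)) add0r.
  by rewrite (law0 (point_resP da_div w)) add0r.
exists (g1 + g2), (f1 + f2), (point_comb w g2), (point_comb w f2); split.
- by split; [exact: graphD|exact: graph_comb].
- by rewrite point_resD // -addrA subrK.
- by rewrite point_resD // -addrA subrK.
apply: le_trans (nsq_point_comb k_div w g2) _.
rewrite exprS -[X in _ <= X]mulrA ler_wpM2l //.
by rewrite mulr_ge0 ?invr_ge0 // addr_ge0 // sumr_ge0 // => i _; exact: csq_ge0.
Qed.

(** By [graph_neumann], each pair of [G] is (U g1, U f1) up to a small remainder, so U disappears
    from [one_point_scaled] in the limit. The remainders in the two spaces cost e / 2 each. *)
Lemma one_point : exists zeta : E1, forall g f a, G (g, f) ->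
  nsq (f + a *: kvec H1 w zeta) <= nsq (g + a *: v).
Proof.
have [_ _ Gle _] := GP; have [zeta zP] := one_point_scaled.
exists zeta => g f a Gx; rewrite -ler_sqrt ?nsq_ge0 //.
apply/ler_addgt0Pr => e e0; have e2 : 0 < (e / 2) ^+ 2 by rewrite exprn_gt0 // divr_gt0.
have rho : 0 <= (1 + ballsq w) / 2 < 1.
  have := ballsq_lt1 w; have : 0 <= ballsq w by apply: sumr_ge0 => i _; exact: csq_ge0.
  by move: (ballsq w) => r *; apply/andP; split; lra.
have [N small] := geometric_vanishing (nsq g) rho e2.
have [g1 [f1 [g2 [f2 [[G1 G2] gE fE le]]]]] := graph_neumann N Gx.
have half (V : hilbertType R) (x : V) : nsq x <= nsq g2 -> Num.sqrt (nsq x) <= e / 2.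
  have -> : e / 2 = Num.sqrt ((e / 2) ^+ 2).
    by rewrite sqrtr_sqr ger0_norm // ltW // divr_gt0.
  move=> xg; rewrite ler_sqrt ?sqr_ge0 //.
  exact/ltW/(le_lt_trans (le_trans xg le)).
have -> : f + a *: kvec H1 w zeta = (point_res w f1 + a *: kvec H1 w zeta) + f2.
  by rewrite fE addrAC.
apply: le_trans (ler_sqrtD _ _) _.
have h1 : Num.sqrt (nsq (point_res w f1 + a *: kvec H1 w zeta)) <=
    Num.sqrt (nsq (point_res w g1 + a *: v)) by rewrite ler_sqrt ?nsq_ge0 // zP.
have h2 : Num.sqrt (nsq (point_res w g1 + a *: v)) <=
    Num.sqrt (nsq (g + a *: v)) + Num.sqrt (nsq (- g2)).
  apply: le_trans (ler_sqrtD _ _); rewrite le_eqVlt; apply/orP; left; apply/eqP.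
  by congr (Num.sqrt (nsq _)); rewrite gE [_ + g2 + _]addrAC addrK.
have h3 := half _ _ (Gle _ _ G2).
have h4 : Num.sqrt (nsq (- g2)) <= e / 2 by apply: half; rewrite nsqN.
move: h1 h2 h3 h4; move: (Num.sqrt _) (Num.sqrt _) (Num.sqrt _) (Num.sqrt _) (Num.sqrt _).
by move=> *; lra.
Qed.

End OnePoint.
End Extension.

(** * Maximal graphs by Zorn's lemma *)

Section MaximalExtension.
Context {R : realType} {n : nat} {k : unit_ball R n -> unit_ball R n -> R[i]}.
Context {E1 E2 : hilbertType R}.
Context (H1 : rkhs (@da_kernel R n) E1) (H2 : rkhs k E2).
Context (k_div : da_divides k).
Let da_div := @da_divides_da R n.

(** Add the line spanned by the new pair: [one_point] gives contractivity, and the common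
    eigenvalues conj(w_i) give invariance. *)
Lemma adjoin_kvec (G : set (H2 * H1)) w eta : coinv_contraction G ->
  exists zeta G', [/\ coinv_contraction G', G `<=` G' &
    G' (kvec H2 w eta, kvec H1 w zeta)].
Proof.
move=> GP; have [zeta zP] := one_point k_div GP w eta.
have [G0 Glin Gle Ginv] := GP.
set v := kvec H2 w eta in zP *; set u := kvec H1 w zeta in zP *.
exists zeta, [set x | exists g f a, G (g, f) /\ x = (g + a *: v, f + a *: u)].
split.
- split.
  + by exists 0, 0, 0; rewrite !scale0r !addr0.
  + move=> b _ _ _ _ [g [f [a [Gx [-> ->]]]]] [g' [f' [a' [Gx' [-> ->]]]]].
    exists (b *: g + g'), (b *: f + f'), (b * a + a'); split; first exact: Glin.
    by rewrite !scalerDr !scalerDl !scalerA; congr (_, _); rewrite addrACA.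
  + by move=> _ _ [g [f [a [Gx [-> ->]]]]]; exact: zP.
  + move=> i _ _ [g [f [a [Gx [-> ->]]]]].
    exists (bshift H2 i g), (bshift H1 i f), (a * conjc (crd w i)).
    split; first exact: Ginv.
    rewrite (lawD (bshiftP k_div i)) (lawD (bshiftP da_div i)).
    rewrite (lawZ (bshiftP k_div i)) (lawZ (bshiftP da_div i)).
    by rewrite !bshift_kvec // !scalerA.
- by move=> [g f] Gx; exists g, f, 0; rewrite !scale0r !addr0.
- by exists 0, 0, 1; rewrite !scale1r !add0r.
Qed.

(** Any two elements of the union lie in one member joined with [G0], and each condition involves at
    most two. Joining with [G0] also covers the empty chain. *)
Lemma coinv_contraction_chain (G0 : set (H2 * H1)) (F : set (set (H2 * H1))) :
  coinv_contraction G0 ->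
  (forall A, F A -> coinv_contraction (G0 `|` A)) -> total_on F subset ->
  coinv_contraction (G0 `|` \bigcup_(A in F) A).
Proof.
move=> G0P FP Ftot; set U := G0 `|` _.
have sub A : F A -> G0 `|` A `<=` U.
  by move=> FA x [?|Ax]; [left|right; exists A].
have one x : U x -> exists Z, [/\ coinv_contraction Z, Z `<=` U, Z x & G0 `<=` Z].
  move=> [G0x|[A FA Ax]]; first by exists G0; split=> // y; left.
  by exists (G0 `|` A); split; [exact: FP|exact: sub|right|move=> y; left].
have two x y : U x -> U y ->
    exists Z, [/\ coinv_contraction Z, Z `<=` U, Z x & Z y].
  move=> [G0x|[A FA Ax]].
    by move=> /one[Z [ZP ZU Zy G0Z]]; exists Z; split=> //; exact: G0Z.
  move=> [G0y|[B FB By]].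
    by exists (G0 `|` A); split; [exact: FP|exact: sub|right|left].
  have [AB|BA] := Ftot _ _ FA FB.
    by exists (G0 `|` B); split; [exact: FP|exact: sub|right; exact: AB|right].
  by exists (G0 `|` A); split; [exact: FP|exact: sub|right|right; exact: BA].
split.
- by left; have [] := G0P.
- move=> a g f g' f' Ux Uy; have [Z [[_ Zlin _ _] ZU Zx Zy]] := two _ _ Ux Uy.
  by apply: ZU; exact: Zlin.
- by move=> g f /one[Z [[_ _ Zle _] _ Zx _]]; exact: Zle.
- by move=> i g f /one[Z [[_ _ _ Zinv] ZU Zx _]]; apply: ZU; exact: Zinv.
Qed.

Lemma exists_total_extension (G0 : set (H2 * H1)) : coinv_contraction G0 ->
  exists2 G, coinv_contraction G & G0 `<=` G /\
    forall w eta, exists zeta, G (kvec H2 w eta, kvec H1 w zeta).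
Proof.
move=> G0P.
have [F FP Ftot|A [AP Amax]] := @Zorn_bigcup _ (fun A => coinv_contraction (G0 `|` A)).
  exact: coinv_contraction_chain.
exists (G0 `|` A) => //; split=> [x|w eta]; first by left.
have [zeta [G' [G'P sub G'v]]] := adjoin_kvec w eta AP.
exists zeta; have AG' : A `<=` G' by move=> x Ax; apply: sub; right.
(* Otherwise G' is strictly larger than A and already contains [G0], against maximality. *)
have [G'A|nG'A] := pselect (G' `<=` A); first by right; exact: G'A.
case: (Amax G'); first by split.
by rewrite (_ : G0 `|` G' = G') //; apply/setUidPr => x G0x; apply: sub; left.
Qed.

End MaximalExtension.

(** * Orthogonal projections onto closed subspaces *)

Section Projection.
Context {R : realType} {H : hilbertType R} (Q : set H) (Q_closed : closed_subspace Q).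

Lemma subspaceP a x y : Q x -> Q y -> Q (a *: x + y).
Proof. by have [_ _ lin] := Q_closed; exact: lin. Qed.

(** Represent u |-> <u, x> on Q. The representing vector is a limit of elements of Q, hence lies in
    Q. *)
Lemma orth_projP x :
  Q (orth_proj Q x) /\ forall u, Q u -> hdot (orth_proj Q x) u = hdot x u.
Proof.
have [cQ Q0 _] := Q_closed; rewrite /orth_proj; case: xgetP => [p _ [Qp pP]|none].
  by split=> // u Qu; apply/esym/eqP; rewrite -subr_eq0 -hdotBl pP.
have [|||p [pE _ app]] := @riesz_rel R H (fun u s => Q u /\ s = hdot u x) (nsq x).
- by rewrite hdot0l.
- move=> a u _ u' _ [Qu ->] [Qu' ->]; split; first exact: subspaceP.
  by rewrite hdotDl hdotZl.
- move=> u _ [_ ->]; have := ip_young u x (@ltr01 R).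
  by rewrite invr1 !mul1r addrC.
case: (none p); split.
  by apply: closed_nsq cQ _ => e /app[u [_ [[Qu _] lt]]]; exists u.
by move=> u Qu; rewrite hdotBl hdotC (pE u (hdot u x)) // -hdotC subrr.
Qed.

Lemma orth_proj_eq x p :
  Q p -> (forall u, Q u -> hdot x u = hdot p u) -> p = orth_proj Q x.
Proof.
move=> Qp pE; have [Qo oE] := orth_projP x.
have Qd : Q (p - orth_proj Q x).
  by rewrite addrC -scaleN1r; exact: subspaceP.
apply/eqP; rewrite -subr_eq0; apply/eqP/nsq_eq0.
by rewrite /nsq /ip hdotBl oE // pE // subrr.
Qed.

End Projection.

(** * Operator norms and squared norms *)

Section OperatorNorm.
Context {R : realType} {U V : hilbertType R}.
Implicit Types (D : set U) (T : U -> V).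

Lemma opnorm_le D T (M : R) : 0 <= M ->
  (forall x, D x -> nsq (T x) <= M * nsq x) -> (opnorm D T <= (Num.sqrt M)%:E)%E.
Proof.
move=> M0 le; apply: ub_ereal_sup => _ [x [Dx /= x1] <-].
rewrite nrmE lee_fin /= ler_sqrt //; apply: le_trans (le _ Dx) _.
rewrite ler_piMr //; move: x1.
by rewrite nrmE -[X in _ <= X]/(1%:C) lecR -[X in _ <= X]sqrtr1 ler_sqrt.
Qed.

Lemma contractionP D T : (forall a x, D x -> D (a *: x)) ->
  (forall a x, D x -> T (a *: x) = a *: T x) -> (opnorm D T <= 1)%E ->
  forall x, D x -> nsq (T x) <= nsq x.
Proof.
move=> DZ TZ le x Dx; have [x0|x0] := eqVneq (nsq x) 0.
  rewrite (nsq_eq0 x0) -[X in T X](scale0r (0 : U)) TZ ?scale0r ?nsq0 //.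
  by have := DZ 0 _ Dx; rewrite scale0r.
have xp : 0 < nsq x by rewrite lt_neqAle eq_sym x0 nsq_ge0.
pose s := Num.sqrt (nsq x); have sp : 0 < s by rewrite sqrtr_gt0.
have s2 : s ^+ 2 = nsq x by rewrite sqr_sqrtr // ltW.
have nE (W : hilbertType R) (y : W) : nsq ((s^-1)%:C *: y) = (nsq x)^-1 * nsq y.
  by rewrite nsqZ csq_real exprVn s2.
have : ((complex.Re `|T ((s^-1)%:C *: x)|)%:E <= opnorm D T)%E.
  apply: ereal_sup_ubound; exists ((s^-1)%:C *: x) => //; split; first exact: DZ.
  by rewrite /= nrmE nE mulVf // sqrtr1.
move=> /le_trans/(_ le); rewrite nrmE lee_fin /= TZ // nE.
rewrite -[X in _ <= X]sqrtr1 ler_sqrt // mulrC ler_pdivrMr //.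
by rewrite mul1r.
Qed.

End OperatorNorm.

(** For x = F(w), |x|^2 = <F, k_w x> and |k_w x|^2 = k(w, w) |x|^2; Young's inequality with weight M
    absorbs one |x|^2. The summand 1 keeps M positive. *)
Lemma nsq_rk_eval {R : realType} {n : nat} {k : unit_ball R n -> unit_ball R n -> R[i]}
    {E : hilbertType R} (H : rkhs k E) w (F : H) :
  nsq (rk_eval H w F) <= (`|complex.Re (k w w)| + 1) * nsq F.
Proof.
set x := rk_eval H w F; set M := _ + 1; have Mp : 0 < M by rewrite ltr_wpDl.
have := ip_young F (kvec H w x) Mp; rewrite ip_kvec -/x -/(nsq x) nsq_kvec mulrA.
have q1 : M^-1 * complex.Re (k w w) <= 1.
  by rewrite ler_pdivrMl // mulr1; have := ler_norm (complex.Re (k w w)); rewrite /M; lra.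
have := ler_wpM2r (nsq_ge0 x) q1; rewrite mul1r.
by move: (nsq F) (nsq x) => a b; lra.
Qed.

(** * The multiplier read off from a graph *)

Section Lifting.
Context {R : realType} {n : nat} {k : unit_ball R n -> unit_ball R n -> R[i]}.
Context {E1 E2 : hilbertType R}.
Context (H1 : rkhs (@da_kernel R n) E1) (H2 : rkhs k E2).
Context (k_div : da_divides k).
Let da_div := @da_divides_da R n.

(* [mul_op H1 H2 Phi] is the adjoint of the contraction with graph [Gam]; it acts
   pointwise because [Gam] pairs kernel vectors with kernel vectors. *)
Lemma multiplier_of_graph (Gam : set (H2 * H1)) : coinv_contraction Gam ->
  (forall w eta, exists zeta, Gam (kvec H2 w eta, kvec H1 w zeta)) ->
  exists Phi, contractive_multiplier H1 H2 Phi /\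
    forall F g f, Gam (g, f) -> hdot (mul_op H1 H2 Phi F) g = hdot F f.
Proof.
move=> [Gam0 Gamlin Gamle _] Gamk.
(* The adjoint applied to F represents g |-> <f, F>, which is bounded because |f| <= |g| on the
   graph. *)
have ex F : exists G : H2, (forall g f, Gam (g, f) -> hdot G g = hdot F f) /\
    nsq G <= nsq F.
  have [|||G [GE GF _]] := @riesz_rel R H2
    (fun g s => exists2 f, Gam (g, f) & s = hdot f F) (nsq F).
  - by exists 0; rewrite ?hdot0l.
  - move=> a g _ g' _ [f Gx ->] [f' Gx' ->]; exists (a *: f + f'); first exact: Gamlin.
    by rewrite hdotDl hdotZl.
  - move=> g _ [f /Gamle fg ->]; have := ip_young f F (@ltr01 R).
    by rewrite invr1 !mul1r addrC => /le_trans; apply; rewrite lerD2l.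
  exists G; split=> // g f Gx.
  by rewrite hdotC -(GE _ (hdot f F)) -?hdotC //; exists f.
have [Y /all_and2[YE Yle]] := choice ex.
have [zeta zetaP] := choice (fun p : unit_ball R n * E2 => Gamk p.1 p.2).
(* The kernel vector at the origin is the constant function e. *)
pose Phi w (e : E1) := rk_eval H2 w (Y (kvec H1 (ball0 n) e)).
(* Since zeta does not depend on F, the value of Y F at w depends only on F(w). *)
have evY F w eta : hdot (rk_eval H2 w (Y F)) eta = hdot (rk_eval H1 w F) (zeta (w, eta)).
  by rewrite -hdot_kvec (YE _ _ _ (zetaP (w, eta))) hdot_kvec.
have PhiE w e eta : hdot (Phi w e) eta = hdot e (zeta (w, eta)).
  by rewrite evY rk_eval_kvec da_kernel0 scale1r.
have YPhi F w : rk_eval H2 w (Y F) = Phi w (rk_eval H1 w F).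
  by apply: hdot_inj => eta; rewrite evY PhiE.
have mulE F : mul_op H1 H2 Phi F = Y F.
  rewrite /mul_op; case: xgetP => [G _ GE|none].
    by apply: (@rk_eval_inj _ _ _ _ H2) => w; rewrite GE YPhi.
  by case: (none (Y F)) => w; exact: YPhi.
exists Phi; split; last by move=> F g f; rewrite mulE; exact: YE.
split; last first.
  rewrite -(@sqrtr1 R); apply: opnorm_le => // F _.
  by rewrite mul1r mulE.
split=> [w|F]; last by exists (Y F) => w; exact: YPhi.
split=> //.
  by move=> a x y _ _; apply: hdot_inj => eta; rewrite hdotDl hdotZl !PhiE hdotDl hdotZl.
pose M := `|complex.Re (k w w)| + 1.
have M0 : 0 <= M by rewrite addr_ge0.
apply: le_lt_trans (@opnorm_le R E1 E2 setT (Phi w) M M0 _) _; last exact: ltry.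
move=> e _; apply: le_trans (nsq_rk_eval w (Y (kvec H1 (ball0 n) e))) _.
apply: ler_wpM2l => //.
apply: le_trans (Yle _) _.
by rewrite nsq_kvec da_kernel0 mul1r.
Qed.

End Lifting.

(** * Commutant lifting for the contraction X *)

Theorem theorem3p4 (R : realType) (n : nat) (n_gt0 : (0 < n)%N)
    (k : unit_ball R n -> unit_ball R n -> R[i]) (k_regular : regular_kernel k)
    (E1 E2 : hilbertType R)
    (H1 : rkhs (da_kernel n) E1) (H2 : rkhs k E2)
    (Q1 : set H1) (Q2 : set H2)
    (Q1_closed : closed_subspace Q1) (Q2_closed : closed_subspace Q2)
    (Q1_coinv : shift_coinvariant H1 Q1) (Q2_coinv : shift_coinvariant H2 Q2)
    (X : H1 -> H2) (X_bounded : bounded_op Q1 Q2 X)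
    (X_contr : (opnorm Q1 X <= 1)%E)
    (X_intertwines : forall (i : 'I_n) (q : H1), Q1 q ->
       X (orth_proj Q1 (coord_shift H1 i q)) = orth_proj Q2 (coord_shift H2 i (X q))) :
  exists Phi : unit_ball R n -> E1 -> E2,
    contractive_multiplier H1 H2 Phi /\
    forall q : H1, Q1 q -> X q = orth_proj Q2 (mul_op H1 H2 Phi q).

Proof.
have k_div : da_divides k.
  by case: k_regular => _ [k' [k'_psd _] kE]; exists k'.
have da_div := @da_divides_da R n.
have [Q1c Q10 _] := Q1_closed; have [Q2c Q20 _] := Q2_closed.
have Q1P := subspaceP Q1_closed; have Q2P := subspaceP Q2_closed.
have [Xlin XQ2 _] := X_bounded.
have Q1Z a x : Q1 x -> Q1 (a *: x) by move=> Qx; have := Q1P a _ _ Qx Q10; rewrite addr0.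
have X0 : X 0 = 0.
  by have := Xlin (-1) _ _ Q10 Q10; rewrite scaler0 addr0 scaleN1r addNr.
have XZ a x : Q1 x -> X (a *: x) = a *: X x.
  by move=> Qx; have := Xlin a _ _ Qx Q10; rewrite X0 !addr0.
have Xle := contractionP Q1Z XZ X_contr.
(* The graph of X^* from Q2 to Q1. *)
pose G0 : set (H2 * H1) := [set x | [/\ Q2 x.1, Q1 x.2 &
  forall q, Q1 q -> hdot (X q) x.1 = hdot q x.2]].
have G0P : coinv_contraction G0.
  split.
  - by split=> // q _; rewrite !hdot0r.
  - move=> a g f g' f' [/= Qg Qf e] [/= Qg' Qf' e'].
    split=> /=; [exact: Q2P|exact: Q1P|move=> q Qq].
    by rewrite !hdotDr !hdotZr e // e'.
  (* Testing with q = f gives |f|^2 = <X f, g>, and |X f| <= |f|. *)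
  - move=> g f [/= _ Qf e]; have := ip_young (X f) g (@ltr01 R).
    have -> : ip (X f) g = nsq f by rewrite /ip e.
    by have := Xle _ Qf; rewrite invr1 !mul1r; move: (nsq _) (nsq _) (nsq _) => *; lra.
  - move=> i g f [/= Qg Qf e]; split=> /=; [exact: Q2_coinv|exact: Q1_coinv|].
    move=> q Qq; rewrite -!hdot_shift //.
    (* As f and g lie in Q1 and Q2, the projections may be inserted before the pairing, which makes
       the intertwining relation applicable. *)
    have [p1Q p1E] := orth_projP Q1_closed (coord_shift H1 i q).
    have [_ p2E] := orth_projP Q2_closed (coord_shift H2 i (X q)).
    by rewrite -p2E // -X_intertwines // e // p1E.
have [Gam GamP [G0Gam Gamk]] := exists_total_extension k_div G0P.
have [Phi [Phi_contr PhiE]] := multiplier_of_graph GamP Gamk.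
exists Phi; split=> // q Qq; apply: orth_proj_eq => // [|u Qu]; first exact: XQ2.
(* With f = X^* u, <Phi q, u> = <q, f> = <X q, u>. Riesz representation on Q1 gives f, and
   closedness puts it in Q1. *)
suff [f G0f] : exists f, G0 (u, f).
  by rewrite (PhiE _ _ f); [case: G0f => _ _ ->|exact: G0Gam].
have [|||f [fE _ app]] := @riesz_rel R H1
  (fun x s => Q1 x /\ s = hdot (X x) u) (nsq u).
- by rewrite X0 hdot0l.
- move=> a x _ x' _ [Qx ->] [Qx' ->]; split; first exact: Q1P.
  by rewrite Xlin // hdotDl hdotZl.
- move=> x _ [Qx ->]; have := ip_young (X x) u (@ltr01 R).
  by rewrite invr1 !mul1r addrC => /le_trans; apply; rewrite lerD2l; exact: Xle.
exists f; split=> //= [|x Qx]; last exact: fE.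
by apply: closed_nsq Q1c _ => e /app[x [_ [[Qx _] lt]]]; exists x.
Qed.
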